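(* The following are equivalent for a positive theory $T$: (i) $T$ is stable; (ii) all formulas in $T$ are stable; (iii) $T$ is $\lambda$-stable for all infinite cardinals $\lambda$ such that $\lambda^{|T|}=\lambda$.
   Context: Positive logic conventions. Fix a first-order signature $\mathcal L$. A formula always means a positive formula: one built from atomic formulas using $\wedge,\vee,\top,\bot,\exists$. A (positive) theory $T$ is a set of h-inductive sentences, i.e. sentences $\forall x(\phi(x)\to\psi(x))$ with $\phi,\psi$ positive formulas. $|T|$ denotes the (infinite) number of $\mathcal L$-formulas. Variables $x,y,\dots$ in formulas are finite tuples. A negation of a formula $\phi(x)$ is a (positive) formula $\psi(x)$ with $T\models\neg\exists x(\phi(x)\wedge\psi(x))$. A model $M$ of $T$ is existentially closed (e.c.) if whenever $M\not\models\phi(a)$ there is a negation $\psi$ of $\phi$ with $M\models\psi(a)$. Standing assumption: $T$ has the joint continuation property (any two models of $T$ admit homomorphisms into a common model of $T$), and one works in a monster model $\mathfrak M$: an e.c. model that is very homogeneous (small tuples have the same positive type over a small set iff conjugate by an automorphism fixing that set) and very saturated (small finitely satisfiable sets of positive formulas over $\mathfrak M$ are satisfiable in $\mathfrak M$). All parameters are in $\mathfrak M$ and parameter sets are small; $\models\phi(a)$ means $\mathfrak M\models\phi(a)$. $\operatorname{tp}(a/B)$ is the set of positive formulas over $B$ satisfied by $a$; $\operatorname{S}_n(B)$ is the set of all $\operatorname{tp}(a/B)$ for $n$-tuples $a$. For a formula $\phi(x,y)$, $\operatorname{tp}_\phi(a/B)=\{\phi(x,b):\ \models\phi(a,b),\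 b\in B\}$ and $\operatorname{S}_\phi(B)$ is the set of all $\operatorname{tp}_\phi(a/B)$. For infinite $\lambda$, $\phi$ is $\lambda$-stable if $|B|\le\lambda$ implies $|\operatorname{S}_\phi(B)|\le\lambda$; $\phi$ is stable if it is $\lambda$-stable for some infinite $\lambda$. For infinite $\lambda$, $T$ is $\lambda$-stable if $|B|\le\lambda$ implies $|\operatorname{S}_n(B)|\le\lambda$ for all $n<\omega$; $T$ is stable if it is $\lambda$-stable for some infinite $\lambda$. *)

(* Defs.v *)
From mathcomp Require Import all_boot all_classical.

Set Implicit Arguments.
Unset Strict Implicit.
Unset Printing Implicit Defensive.

Local Open Scope classical_set_scope.
Local Open Scope card_scope.

Record signature := Signature {
  fsym : Type;
  farity : fsym -> nat;
  rsym : Type;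
  rarity : rsym -> nat }.

(* Free variables are indexed by 'I_n; constants are function symbols of
   arity 0. *)
Inductive term (L : signature) (n : nat) : Type :=
  | Var of 'I_n
  | App (f : fsym L) of ('I_(farity f) -> term L n).

(* Positive formulas with free variables in 'I_n; [Ex] binds variable 0 of its
   body, variable i.+1 of which is variable i outside. *)
Inductive formula (L : signature) : nat -> Type :=
  | Top n : formula L n
  | Bot n : formula L n
  | Eq n of term L n & term L n : formula L n
  | Rel n (r : rsym L) of ('I_(rarity r) -> term L n) : formula L n
  | And n of formula L n & formula L n : formula L n
  | Or n of formula L n & formula L n : formula L n
  | Ex n of formula L n.+1 : formula L n.

(* All formulas; the cardinality of this type is |T|. *)
Definition all_formulas (L : signature) : Type := {n : nat & formula L n}.

Record structure (L : signature) := Structure {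
  carrier :> Type;
  carrier_inhabited : inhabited carrier;
  fint : forall f : fsym L, (farity f).-tuple carrier -> carrier;
  rint : forall r : rsym L, (rarity r).-tuple carrier -> Prop }.

Arguments fint {L} s f _.
Arguments rint {L} s r _.

Fixpoint eval (L : signature) (M : structure L) (n : nat) (v : n.-tuple M)
    (t : term L n) : M :=
  match t with
  | Var i => tnth v i
  | App f ts => fint M f (mktuple (fun i => eval v (ts i)))
  end.

Fixpoint holds (L : signature) (M : structure L) (n : nat)
    (phi : formula L n) : n.-tuple M -> Prop :=
  match phi with
  | Top _ => fun _ => True
  | Bot _ => fun _ => False
  | Eq _ t u => fun v => eval v t = eval v u
  | Rel _ r ts => fun v => rint M r (mktuple (fun i => eval v (ts i)))
  | And _ phi1 phi2 => fun v => holds phi1 v /\ holds phi2 v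
  | Or _ phi1 phi2 => fun v => holds phi1 v \/ holds phi2 v
  | Ex _ psi => fun v => exists a : M, holds psi (cons_tuple a v)
  end.

(* The h-inductive sentence: forall x, hyp x -> concl x. *)
Record hsentence (L : signature) := HSentence {
  hvars : nat;
  hyp : formula L hvars;
  concl : formula L hvars }.

Definition theory (L : signature) := set (hsentence L).

Definition model (L : signature) (T : theory L) (M : structure L) : Prop :=
  forall s, T s ->
  forall v : (hvars s).-tuple M, holds (hyp s) v -> holds (concl s) v.

Definition homomorphism (L : signature) (M N : structure L) (h : M -> N) : Prop :=
  (forall (f : fsym L) (v : (farity f).-tuple M),
     h (fint M f v) = fint N f (map_tuple h v)) /\
  (forall (r : rsym L) (v : (rarity r).-tuple M),
     rint M r v -> rint N r (map_tuple h v)).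

Definition automorphism (L : signature) (M : structure L) (h : M -> M) : Prop :=
  homomorphism h /\
  exists g : M -> M, [/\ homomorphism g, cancel h g & cancel g h].

Definition joint_continuation (L : signature) (T : theory L) : Prop :=
  forall M N : structure L, model T M -> model T N ->
  exists P : structure L, model T P /\
    (exists f : M -> P, homomorphism f) /\ (exists g : N -> P, homomorphism g).

(* T |= ~ exists x, phi x /\ psi x *)
Definition negation (L : signature) (T : theory L) (n : nat)
    (phi psi : formula L n) : Prop :=
  forall M : structure L, model T M ->
  ~ exists v : n.-tuple M, holds (And phi psi) v.

Definition existentially_closed (L : signature) (T : theory L)
    (M : structure L) : Prop :=
  model T M /\
  forall (n : nat) (phi : formula L n) (a : n.-tuple M), ~ holds phi a ->
  exists psi : formula L n, negation T phi psi /\ holds psi a.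

(* [PFormula phi xs ps] is the formula phi(xs, ps) with variables from V and
   parameters from P.  V need not be finite: it may index a long tuple. *)
Record pformula (L : signature) (V P : Type) := PFormula {
  pvars : nat;
  ppars : nat;
  pbody : formula L (pvars + ppars);
  pvar : pvars.-tuple V;
  ppar : ppars.-tuple P }.

Definition psat (L : signature) (M : structure L) (V : Type) (a : V -> M)
    (theta : pformula L V M) : Prop :=
  holds (pbody theta) (cat_tuple (map_tuple a (pvar theta)) (ppar theta)).

Definition tuple_in (M : Type) (B : set M) (n : nat) (b : n.-tuple M) : Prop :=
  forall i, B (tnth b i).

Definition tp (L : signature) (M : structure L) (V : Type) (a : V -> M)
    (B : set M) : set (pformula L V M) :=
  [set theta | tuple_in B (ppar theta) /\ psat a theta].

Definition types (L : signature) (M : structure L) (n : nat) (B : set M) :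
    set (set (pformula L 'I_n M)) :=
  [set tp (tnth a) B | a in [set: n.-tuple M]].

Arguments types {L M} n B.

(* phi(x, b) *)
Definition instance (L : signature) (M : structure L) (n m : nat)
    (phi : formula L (n + m)) (b : m.-tuple M) : pformula L 'I_n M :=
  PFormula phi (ord_tuple n) b.

Definition tp_phi (L : signature) (M : structure L) (n m : nat)
    (phi : formula L (n + m)) (a : n.-tuple M) (B : set M) :
    set (pformula L 'I_n M) :=
  [set instance phi b | b in
     [set b : m.-tuple M | tuple_in B b /\ psat (tnth a) (instance phi b)]].

Definition types_phi (L : signature) (M : structure L) (n m : nat)
    (phi : formula L (n + m)) (B : set M) : set (set (pformula L 'I_n M)) :=
  [set tp_phi phi a B | a in [set: n.-tuple M]].

Definition card_lt (T U : Type) (A : set T) (B : set U) : Prop :=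
  A #<= B /\ ~ (B #<= A).

(* Cardinals are represented by types.  A monster model comes with a cardinal
   K, and small means of cardinality < K. *)
Definition small (K T : Type) (A : set T) : Prop := card_lt A [set: K].

Definition homogeneous (K : Type) (L : signature) (M : structure L) : Prop :=
  forall (I : Type) (a b : I -> M) (C : set M),
  small K [set: I] -> small K C ->
  (tp a C = tp b C <->
   exists h : M -> M, [/\ automorphism h,
     forall c, C c -> h c = c & forall i, h (a i) = b i]).

Definition saturated (K : Type) (L : signature) (M : structure L) : Prop :=
  forall (V : Type) (Sigma : set (pformula L V M)), small K Sigma ->
  (forall F : set (pformula L V M), finite_set F -> F `<=` Sigma ->
     exists a : V -> M, forall theta, F theta -> psat a theta) ->
  exists a : V -> M, forall theta, Sigma theta -> psat a theta.

(* [monster_large] is 2^|T| < K: all that is used of the usual convention that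
   K exceeds the cardinals under consideration. *)
Record monster (K : Type) (L : signature) (T : theory L) := Monster {
  monster_structure :> structure L;
  monster_large : small K [set: all_formulas L -> bool];
  monster_ec : existentially_closed T monster_structure;
  monster_homogeneous : homogeneous K monster_structure;
  monster_saturated : saturated K monster_structure }.

(* An infinite cardinal over which one may take parameter sets.  Without
   smallness every theory would be lambda-stable for the lambda that are large
   compared to the monster model. *)
Definition small_infinite (K Lam : Type) : Prop :=
  infinite_set [set: Lam] /\ small K [set: Lam].

Section Stability.
Variables (K : Type) (L : signature) (T : theory L) (M : monster K T).

Definition lambda_stable_formula (Lam : Type) (n m : nat)
    (phi : formula L (n + m)) : Prop :=
  forall B : set M, B #<= [set: Lam] -> types_phi phi B #<= [set: Lam].

Definition stable_formula (n m : nat) (phi : formula L (n + m)) : Prop :=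
  exists Lam : Type, small_infinite K Lam /\ lambda_stable_formula Lam phi.

Definition lambda_stable (Lam : Type) : Prop :=
  forall B : set M, B #<= [set: Lam] ->
  forall n : nat, types n B #<= [set: Lam].

Definition stable : Prop :=
  exists Lam : Type, small_infinite K Lam /\ lambda_stable Lam.

End Stability.

Arguments stable_formula {K L T} M {n m} phi.
Arguments lambda_stable {K L T} M Lam.
Arguments stable {K L T} M.

(* Main.v *)
Require Import Defs.
From mathcomp Require Import all_boot all_classical.
From mathcomp Require Import wochoice.

Set Implicit Arguments.
Unset Strict Implicit.
Unset Printing Implicit Defensive.

Local Open Scope classical_set_scope.
Local Open Scope card_scope.

(** Two implications are soft. A type over B determines its phi-part, so a
    stable theory has stable formulas, with the same cardinal; and 2^|T| is a
    small infinite cardinal equal to its own |T|-th power, so that stability in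
    all such cardinals is not a vacuous condition and gives stability. The
    substance is that stability of every formula implies Lam-stability as soon
    as Lam^|T| = Lam.

    Fix phi(x, y) and a negation psi of phi. Consider binary trees whose nodes
    carry parameters b, and where a branch through such a node asserts phi(x, b)
    on one side and psi(x, b) on the other; [tree_rank_ge k S] says that there
    is a full tree of height k all of whose branches are realized in S.

    - If phi is stable, then the heights of these trees are bounded
      ([stable_finite_rank]). Suppose they are not, and let phi be stable in
      Lam. There is an order type mu inside a well-order of Lam with 2^mu > Lam
      but 2^nu <= Lam for all proper initial segments nu of mu
      ([critical_height]). Saturation glues the finite trees into a tree of
      height mu, with at most Lam nodes ([saturated_tree]), and then realizes
      each of its branches ([saturated_branch]). Distinct branches have distinct
      phi-types over the at most Lam parameters in the tree, because phi and psi
      are incompatible: this contradicts stability in Lam.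

    - If these heights are bounded for each psi, then phi has few types
      ([finite_rank_types_phi]). For each a and psi choose finitely many
      instances of phi and psi over B that hold of a and cut out a set of
      least possible rank. Two tuples a and a' with the same choice for psi
      cannot be told apart by phi(a, b) and psi(a', b) with b in B: both halves
      of the common set would keep its rank, which would then be infinite
      ([minimizing_separates]). As M is existentially closed, any failure of
      phi(a', b) is witnessed by some psi, so the function sending psi to the
      chosen instances determines the phi-type of a. There are at most Lam^|T|
      such functions.

    - The type of a tuple is determined by the phi-types of its subtuples, one
      for each phi, so again there are at most Lam^|T| types
      ([types_of_types_phi]).

    All these counts rest on Lam * Lam = Lam for infinite Lam
    ([card_le_square]), obtained from Zorn's lemma. *)

(** * Cardinal arithmetic *)

(** A form of [set_inj] whose hypotheses are plain propositions. *)
Definition injective_on T U (A : set T) (f : T -> U) : Prop :=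
  forall x y, A x -> A y -> f x = f y -> x = y.

Lemma card_le_inj T U (A : set T) (B : set U) (f : T -> U) :
  set_fun A B f -> injective_on A f -> A #<= B.
Proof.
move=> fAB fI.
suff /injfunPex[g] : exists2 f : T -> U, set_fun A B f & set_inj A f.
  exact: inj_card_le.
by exists f => // x y /set_mem Ax /set_mem Ay; exact: fI.
Qed.

Lemma card_le_injP T U (A : set T) (B : set U) (u : U) :
  A #<= B -> exists2 f : T -> U, set_fun A B f & injective_on A f.
Proof.
elim/Ppointed: U B u => U B u; first by case: (no u).
move=> /pcard_leP/injfunPex[f fAB fI]; exists f => // x y Ax Ay.
by apply: fI; exact: mem_set.
Qed.

Lemma choice_on T U (A : set T) (R : T -> U -> Prop) (u : U) :
  (forall a, A a -> exists b, R a b) -> exists f, forall a, A a -> R a (f a).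
Proof.
move=> AR; suff /choice[f fR] : forall a, exists b, A a -> R a b by exists f.
by move=> a; have [/AR[b Rab]|nAa] := pselect (A a); [exists b|exists u].
Qed.

(** A maximal partial injection between A and B, given by its graph, has full
    domain or full range: otherwise one more pair could be added. *)
Lemma card_le_total T U (A : set T) (B : set U) : A #<= B \/ B #<= A.
Proof.
pose P (G : set (T * U)) := G `<=` A `*` B /\
  forall p q, G p -> G q -> (p.1 = q.1 <-> p.2 = q.2).
have [F FP Ftot|G [[GAB GI] Gmax]] := @Zorn_bigcup _ P.
  split=> [p [X FX Xp]|p q [X FX Xp] [Y FY Yq]]; first exact: (FP _ FX).1.
  have [XY|YX] := Ftot _ _ FX FY.
    by apply: (FP _ FY).2 => //; exact: XY.
  by apply: (FP _ FX).2 => //; exact: YX.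
have [tot|/existsNP[a /not_implyP[Aa na]]] :=
    pselect (forall a, A a -> exists b, G (a, b)).
  have [->|/set0P[a0 Aa0]] := eqVneq A set0; first by left; exact: card_ge0.
  have [b0 _] := tot _ Aa0.
  left; have [f fG] := choice_on b0 tot.
  apply: (@card_le_inj _ _ _ _ f) => [a /fG/GAB[]//|x y].
  by move=> /fG gx /fG gy /(GI _ _ gx gy).
have [tot|/existsNP[b /not_implyP[Bb nb]]] :=
    pselect (forall b, B b -> exists a, G (a, b)).
  right; have [f fG] := choice_on a tot.
  apply: (@card_le_inj _ _ _ _ f) => [b /fG/GAB[]//|x y].
  by move=> /fG gx /fG gy /(GI _ _ gx gy).
exfalso; apply: (Gmax (G `|` [set (a, b)])).
  by split; [left | move=> /(_ (a, b) (or_intror erefl)) Gab; apply: na; exists b].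
split=> [p [/GAB//|->]//|p q [Gp|->] [Gq|->]//=]; first exact: GI.
- case: p Gp => x y Gp /=; split=> e; exfalso.
    by apply: na; exists y; rewrite -e.
  by apply: nb; exists x; rewrite -e.
- case: q Gq => x y Gq /=; split=> e; exfalso.
    by apply: na; exists y; rewrite e.
  by apply: nb; exists x; rewrite e.
Qed.

Definition square_injection T (A : set T) (f : T * T -> T) : Prop :=
  [/\ infinite_set A, set_fun (A `*` A) A f & injective_on (A `*` A) f].

(** A union of two sets no larger than A embeds in two disjoint copies of A,
    which f places inside A as the pairs with first component [c 0] or
    [c 1]. *)
Lemma square_injection_setU T (A C : set T) (f : T * T -> T) :
  square_injection A f -> C #<= A -> A `|` C #<= A.
Proof.
move=> [infA fA fI] CA.
have [x0 _] := infinite_setN0 infA.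
have [c cA cI] := card_le_injP x0 ((infiniteP _).1 infA).
have [g gA gI] := card_le_injP x0 CA.
pose k x := if pselect (A x) then f (c 0, x) else f (c 1, g x).
have c01 : c 0 <> c 1 by move=> /(cI _ _ I I).
apply: (@card_le_inj _ _ _ _ k) => [x ACx|x y ACx ACy].
  rewrite /k; case: pselect => Ax; first by apply: fA; split=> //; exact: cA.
  by apply: fA; split; [exact: cA|apply: gA; case: ACx].
have inS n v : A v -> (A `*` A) (c n, v) by split=> //; exact: cA.
rewrite /k; case: pselect => Ax; case: pselect => Ay.
- by move=> /(fI _ _ (inS _ _ Ax) (inS _ _ Ay))[].
- by case: ACy => // /gA Agy /(fI _ _ (inS _ _ Ax) (inS _ _ Agy))[].
- by case: ACx => // /gA Agx /(fI _ _ (inS _ _ Agx) (inS _ _ Ay))[/esym].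
- case: ACx => // Cx; case: ACy => // Cy.
  by move=> /(fI _ _ (inS _ _ (gA _ Cx)) (inS _ _ (gA _ Cy)))[/(gI _ _ Cx Cy)].
Qed.

Lemma square_injection_exists T :
  infinite_set [set: T] -> exists p : set T * (T * T -> T), square_injection p.1 p.2.
Proof.
move=> infT; have [x0 _] := infinite_setN0 infT.
have [c _ cI] := card_le_injP x0 ((infiniteP _).1 infT).
have /(card_le_injP 0)[e _ eI] : [set: nat * nat] #<= [set: nat].
  by have /card_eqPle[] := card_nat2.
have [d dP] : exists d : T -> nat, forall n, d (c n) = n.
  have [|d dc] := @choice_on T nat (range c) (fun x n => c n = x) 0.
    by move=> _ [n _ <-]; exists n.
  by exists d => n; apply: cI => //; apply: dc; exists n.
exists (range c, fun p => c (e (d p.1, d p.2))); split=> /=.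
- by apply/infiniteP; apply: (@card_le_inj _ _ _ _ c) => // n _; exists n.
- by move=> p _; exists (e (d p.1, d p.2)).
- move=> [_ _] [_ _] /= [[m _ <-] [n _ <-]] [[m' _ <-] [n' _ <-]].
  by rewrite !dP => /(cI _ _ I I)/(eI _ _ I I)[-> ->].
Qed.

(** Zorn's lemma gives a maximal infinite A with an injection of A * A into A.
    If the complement of A embeds in A, then the whole type does, and the
    injection for A transfers to it. Otherwise the complement contains a copy C
    of A, and the injection extends to A `|` C by sending the new pairs into C,
    against maximality. *)
Lemma card_le_square T : infinite_set [set: T] -> [set: T * T] #<= [set: T].
Proof.
move=> infT; have [p0 p0P] := square_injection_exists infT.
have [x0 _] := infinite_setN0 infT.
pose S := {p : set T * (T * T -> T) | square_injection p.1 p.2}.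
pose le (p q : S) : bool := `[< (sval p).1 `<=` (sval q).1 /\
  forall x, ((sval p).1 `*` (sval p).1) x -> (sval p).2 x = (sval q).2 x >].
have leP p q : reflect ((sval p).1 `<=` (sval q).1 /\
  forall x, ((sval p).1 `*` (sval p).1) x -> (sval p).2 x = (sval q).2 x) (le p q).
  by rewrite /le; apply: asboolP.
have [t|p q r|C Ctot|] := @ZL_preorder S (exist _ p0 p0P) le.
- by apply/leP; split.
- move=> /leP[pq epq] /leP[qr eqr]; apply/leP; split; first exact: subset_trans qr.
  by move=> x [px1 px2]; rewrite epq//; apply: eqr; split; exact: pq.
- have [C0|/existsNP[p1 /contrapT Cp1]] := pselect (forall p, ~ C p).
    by exists (exist _ p0 p0P) => s /C0.
  pose A := \bigcup_(p in C) (sval p).1.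
  have AP x : (A `*` A) x -> exists2 p, C p & ((sval p).1 `*` (sval p).1) x.
    case=> -[p Cp px] [q Cq qy]; have [/leP[pq _]|/leP[qp _]] := Ctot _ _ Cp Cq.
      by exists q => //; split=> //; exact: pq.
    by exists p => //; split=> //; exact: qp.
  have [f fP] : exists f : T * T -> T, forall p, C p ->
      forall x, ((sval p).1 `*` (sval p).1) x -> f x = (sval p).2 x.
    have [|f fP] := @choice_on _ _ (A `*` A) (fun x z => forall p, C p ->
      ((sval p).1 `*` (sval p).1) x -> z = (sval p).2 x) x0.
      move=> x /AP[p Cp px]; exists ((sval p).2 x) => q Cq qx.
      by have [/leP[_ ->]|/leP[_ ->]] := Ctot _ _ Cp Cq.
    exists f => p Cp x px; apply: fP => //.
    by split; exists p => //; case: px.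
  have sqA : square_injection A f.
    split.
    + by case: (svalP p1) => + _ _; apply: sub_infinite_set => x p1x; exists p1.
    + move=> x /AP[p Cp px]; rewrite (fP _ Cp)//; exists p => //.
      by case: (svalP p) => _ + _; apply.
    + move=> x y /AP[p Cp px] /AP[q Cq qy].
      have [/leP[pq _]|/leP[qp _]] := Ctot _ _ Cp Cq.
        have qx : ((sval q).1 `*` (sval q).1) x by case: px; split; exact: pq.
        by rewrite !(fP _ Cq)//; case: (svalP q) => _ _; apply.
      have py : ((sval p).1 `*` (sval p).1) y by case: qy; split; exact: qp.
      by rewrite !(fP _ Cp)//; case: (svalP p) => _ _; apply.
  exists (exist _ (A, f) sqA) => p Cp; apply/leP; split=> /=.
    by move=> x px; exists p.
  by move=> x px; rewrite (fP _ Cp).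
- move=> [[A f] /= sq] max.
  have [infA fA fI] := sq.
  have [AC|CA] := card_le_total A (~` A); last first.
    have := square_injection_setU sq CA.
    rewrite setUv => /(card_le_injP x0)[k kA kI].
    apply: (@card_le_inj _ _ _ _ (fun p => f (k p.1, k p.2))) => // -[x1 x2] [y1 y2] _ _.
    have kkA u v : (A `*` A) (k u, k v) by split; exact: kA.
    by move=> /(fI _ _ (kkA _ _) (kkA _ _))[/(kI _ _ I I)-> /(kI _ _ I I)->].
  have [g gC gI] := card_le_injP x0 AC.
  have /(square_injection_setU sq)/(card_le_injP x0)[k kA kI] : g @` A #<= A.
    exact: card_image_le.
  pose B := A `|` g @` A.
  (* k maps B into A, so g maps the new pairs into the copy g @` A of A. *)
  pose h p := if pselect ((A `*` A) p) then f p else g (f (k p.1, k p.2)).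
  have kkA p : (B `*` B) p -> (A `*` A) (k p.1, k p.2).
    by case=> ? ?; split; exact: kA.
  have sqB : square_injection B h.
    split; first by apply: sub_infinite_set infA => x; left.
      move=> p Bp; rewrite /h; case: pselect => Ap; first by left; exact: fA.
      by right; exists (f (k p.1, k p.2)) => //; apply/fA/kkA.
    have fg p q : (A `*` A) p -> (B `*` B) q -> f p <> g (f (k q.1, k q.2)).
      by move=> /fA Ap /kkA/fA/gC; rewrite /setC/= => + e; rewrite -e.
    move=> p q Bp Bq; rewrite /h.
    case: pselect => Ap; case: pselect => Aq /= e.
    + exact: fI.
    + by case: (fg _ _ Ap Bq).
    + by case: (fg _ _ Aq Bp).
    + move: p q Bp Bq {Ap Aq} e => [p1 p2] [q1 q2] Bp Bq.
      move=> /(gI _ _ (fA _ (kkA _ Bp)) (fA _ (kkA _ Bq))).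
      move=> /(fI _ _ (kkA _ Bp) (kkA _ Bq))[].
      by case: Bp Bq => /= Bp1 Bp2 [Bq1 Bq2] /kI-> // /kI->.
  have /leP[BA _] : le (exist _ (B, h) sqB) (exist _ (A, f) sq).
    apply: max; apply/leP; split=> /=; first by move=> x; left.
    by move=> x Ax; rewrite /h; case: pselect.
  have [a Aa] := infinite_setN0 infA.
  by case: (gC _ Aa); apply: BA; right; exists a.
Qed.

Section InfiniteCardinal.
Variables (Lam : Type) (infLam : infinite_set [set: Lam]).

Let lam0 : Lam.
Proof. by have /cid[] : [set: Lam] !=set0 := infinite_setN0 infLam. Qed.

Lemma card_le_image_le T U (A : set T) (f : T -> U) :
  A #<= [set: Lam] -> f @` A #<= [set: Lam].
Proof. exact/card_le_trans/card_image_le. Qed.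

Lemma finite_card_le T (A : set T) : finite_set A -> A #<= [set: Lam].
Proof. by move/finite_set_countable/card_le_trans; apply; exact/infiniteP. Qed.

Lemma card_le_setX T U (A : set T) (B : set U) :
  A #<= [set: Lam] -> B #<= [set: Lam] -> A `*` B #<= [set: Lam].
Proof.
move=> /(card_le_injP lam0)[f _ fI] /(card_le_injP lam0)[g _ gI].
have [p _ pI] := card_le_injP lam0 (card_le_square infLam).
apply: (@card_le_inj _ _ _ _ (fun x => p (f x.1, g x.2))) => //.
move=> [x1 x2] [y1 y2] [/= Ax Bx] [/= Ay By] /(pI _ _ I I)[].
by move=> /(fI _ _ Ax Ay)-> /(gI _ _ Bx By)->.
Qed.

Lemma card_le_bigcup J U (D : set J) (F : J -> set U) :
  D #<= [set: Lam] -> (forall i, D i -> F i #<= [set: Lam]) ->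
  \bigcup_(i in D) F i #<= [set: Lam].
Proof.
move=> DLam FLam.
have [|j jI] := @choice_on _ _ D (fun i (f : U -> Lam) => injective_on (F i) f)
    (fun=> lam0).
  by move=> i /FLam/(card_le_injP lam0)[f _ fI]; exists f.
have [|i iP] := @choice_on _ _ (\bigcup_(i in D) F i)
    (fun u (k : option J) => exists2 i, k = Some i & D i /\ F i u) None.
  by move=> u [k Dk Fku]; exists (Some k), k.
have [d _ dI] := card_le_injP lam0 DLam.
have [p _ pI] := card_le_injP lam0 (card_le_square infLam).
pose code u := if i u is Some k then p (d k, j k u) else lam0.
apply: (@card_le_inj _ _ _ _ code) => // u v.
move=> /iP[k ek [Dk Fk]] /iP[l el [Dl Fl]]; rewrite /code ek el.
move=> /(pI _ _ I I)[/(dI _ _ Dk Dl) kl]; rewrite -kl in Fl *.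
exact: jI.
Qed.

Lemma card_le_setU U (A B : set U) :
  A #<= [set: Lam] -> B #<= [set: Lam] -> A `|` B #<= [set: Lam].
Proof.
move=> ALam BLam; have -> : A `|` B = \bigcup_(b in [set: bool]) (if b then A else B).
  apply/seteqP; split=> [x [Ax|Bx]|x [[] _ ?]]; try by [left|right].
    by exists true.
  by exists false.
apply: card_le_bigcup => [|[] _ //]; exact: finite_card_le.
Qed.

(** A list is coded by iterated pairing; the components [c 0] and [c 1]
    distinguish the empty list from the others, so lists of different lengths
    have different codes. *)
Lemma card_le_seq U (A : set U) : A #<= [set: Lam] ->
  [set s : seq U | all (fun x => `[< A x >]) s] #<= [set: Lam].
Proof.
move=> /(card_le_injP lam0)[f _ fI].
have [c _ cI] := card_le_injP lam0 ((infiniteP _).1 infLam).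
have [p _ pI] := card_le_injP lam0 (card_le_square infLam).
have c01 : c 0 <> c 1 by move=> /(cI _ _ I I).
pose code := foldr (fun x a => p (c 1, p (f x, a))) (p (c 0, lam0)).
apply: (@card_le_inj _ _ _ _ code) => // s; elim: s => [|x s IH] [|y t] //=.
- by move=> _ _ /(pI _ _ I I)[/c01].
- by move=> _ _ /(pI _ _ I I)[/esym/c01].
- move=> /andP[/asboolP Ax As] /andP[/asboolP Ay At].
  move=> /(pI _ _ I I)[/(pI _ _ I I)[/(fI _ _ Ax Ay)-> /(IH _ As At)->]].
  by [].
Qed.

Lemma card_le_tuple U (A : set U) m : A #<= [set: Lam] ->
  [set b : m.-tuple U | tuple_in A b] #<= [set: Lam].
Proof.
move=> /card_le_seq; apply: card_le_trans.
apply: (@card_le_inj _ _ _ _ val) => [b Ab|b c _ _ /val_inj//].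
by apply/all_tnthP => i; apply/asboolP/Ab.
Qed.

Lemma Cantor_subsets (U : Type) : ~ ([set: set U] #<= [set: U]).
Proof.
elim/Ppointed: U => U; first by rewrite card_le_emptyr => /eqP/seteqP[/(_ set0 I)].
move=> le.
have [f _ fI] := card_le_injP point le.
pose D := [set u | forall A, f A = u -> ~ A u].
have nD : ~ D (f D) by move=> /[dup]/[swap]; apply.
by apply: (nD) => A /(fI _ _ I I)->.
Qed.

End InfiniteCardinal.

(** * Subsets of a well-order *)

Record strict_well_order T (lt : T -> T -> Prop) : Prop := StrictWellOrder {
  swo_irr : forall x, ~ lt x x;
  swo_trans : forall y x z, lt x y -> lt y z -> lt x z;
  swo_total : forall x y, [\/ x = y, lt x y | lt y x];
  swo_min : forall A : set T, A !=set0 ->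
    exists2 m, A m & forall x, A x -> ~ lt x m }.

Lemma strict_well_order_exists T : exists lt : T -> T -> Prop, strict_well_order lt.
Proof.
elim/Peq: T => T; have [R woR] := well_ordering_principle T.
have woC : @wo_chain T R predT by move=> A _; exact: woR.
have tot x y : R x y || R y x by exact: (wo_chainW woC).
have refl x : R x x by have := tot x x; rewrite orbb.
have anti x y : R x y -> R y x -> x = y.
  by move=> xy yx; apply: (wo_chain_antisymmetric woC) => //; rewrite xy.
have min (A : set T) : A !=set0 -> exists2 m, A m & forall x, A x -> R m x.
  move=> [a Aa]; have [|m [[Am mP] _]] := woR [pred x | `[< A x >]].
    by exists a; apply/asboolP.
  by exists m; [exact/asboolP|move=> x Ax; apply: mP; exact/asboolP].
exists (fun x y => R x y /\ x <> y); split.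
- by move=> x [].
- move=> y x z [Rxy xy] [Ryz yz].
  have [|m xyzm mP] := min [set x; y; z]; first by exists x; left; left.
  have Rxz : R x z.
    case: xyzm => [[]|] /= e; rewrite {m}e in mP.
    - by apply: mP; right.
    - by case: xy; apply: anti => //; apply: mP; left; left.
    - by case: yz; apply: anti => //; apply: mP; left; right.
  by split=> // e; apply: xy; apply: anti => //; rewrite e.
- move=> x y; have [->|xy] := pselect (x = y); first by constructor 1.
  have /orP[Rxy|Ryx] := tot x y; first by constructor 2.
  by constructor 3; split=> //; exact: nesym.
- move=> A /min[m Am mP]; exists m => // x Ax [Rxm xm].
  by apply: xm; apply: anti => //; exact: mP.
Qed.

Definition initial_segment T (lt : T -> T -> Prop) (x : T) : set T :=
  [set y | lt y x].

(** Subsets of mu are the branches of a binary tree, and subsets of the initial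
    segment below y are its nodes at level y: the tree has few nodes but many
    branches. If some initial segment has more than Lam subsets, mu is the least
    such segment; if none does, mu is everything, by Cantor's theorem. *)
Lemma critical_height (Lam : Type) (lt : Lam -> Lam -> Prop) :
  strict_well_order lt ->
  exists mu : set Lam,
    ~ ([set f | f `<=` mu] #<= [set: Lam]) /\
    forall y, mu y -> [set f | f `<=` initial_segment lt y] #<= [set: Lam].
Proof.
move=> wo; pose seg := initial_segment lt.
have [small|/existsNP big] :=
    pselect (forall y, [set f | f `<=` seg y] #<= [set: Lam]).
  exists setT; split=> // le; apply: (@Cantor_subsets Lam).
  by apply: card_le_trans le; exact: subset_card_le.
have [y ybig ymin] := swo_min wo big.
by exists (seg y); split=> // z zy; apply: contrapT => /ymin.
Qed.

(** These are the nodes of the tree together with one step out of them. *)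
Lemma card_le_bounded_subsets (Lam : Type) (lt : Lam -> Lam -> Prop) (mu : set Lam) :
  infinite_set [set: Lam] ->
  (forall y, mu y -> [set f | f `<=` initial_segment lt y] #<= [set: Lam]) ->
  \bigcup_(y in mu) [set f | f `<=` y |` initial_segment lt y] #<= [set: Lam].
Proof.
move=> infLam muP; apply: card_le_bigcup => // [|y /muP Py]; first exact: card_leT.
have /(card_le_setU infLam Py) :
    (fun f => y |` f) @` [set f | f `<=` initial_segment lt y] #<= [set: Lam].
  exact: card_le_image_le.
apply: card_le_trans; apply: subset_card_le => f fy.
have [fy'|nfy] := pselect (f y).
  right; exists (f `&` initial_segment lt y); first by move=> z [].
  apply/seteqP; split=> [z [->//|[]//]|z fz].
  by have [->|zy] := fy _ fz; [left|right].
by left=> z fz; have [zy|//] := fy _ fz; rewrite zy in fz.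
Qed.

Lemma finite_strictly_sorted (T : eqType) (lt : T -> T -> Prop) (A : set T) :
  strict_well_order lt -> finite_set A ->
  exists2 s, pairwise (fun x y => `[< lt x y >]) s & forall x, A x <-> x \in s.
Proof.
move=> wo /finite_seqP[s0 ->].
pose le x y := `[< ~ lt y x >].
have le_tot : total le.
  move=> x y; apply/orP; have [yx|nyx] := pselect (lt y x); last by left; apply/asboolP.
  by right; apply/asboolP => xy; apply: (swo_irr wo); exact: (swo_trans wo xy yx).
have le_tr : transitive le.
  move=> y x z /asboolP xy /asboolP yz; apply/asboolP => zx.
  have [e|yx|yx] := swo_total wo x y; last by [].
    by apply: yz; rewrite -e.
  by apply: yz; exact: (swo_trans wo zx yx).
exists (sort le (undup s0)); last by move=> x; rewrite mem_sort mem_undup.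
have : pairwise (fun x y => le x y && (x != y)) (sort le (undup s0)).
  rewrite pairwise_relI -sorted_pairwise// sort_sorted//=.
  by have := undup_uniq s0; rewrite -(sort_uniq le) uniq_pairwise.
apply: sub_pairwise => x y /andP[/asboolP yx /eqP xy]; apply/asboolP.
by have [/xy| |/yx] := swo_total wo x y.
Qed.

(** * Ranks of binary trees *)

Section TreeRank.
Variables (X Y : Type) (P Q : X -> Y -> Prop).

(** This is Shelah's binary rank restricted to a single pair of relations: the
    sets S need not be definable. *)
Fixpoint tree_rank_ge (k : nat) (S : set X) : Prop :=
  if k is k'.+1 then exists y, tree_rank_ge k' (S `&` P^~ y) /\
                               tree_rank_ge k' (S `&` Q^~ y)
  else S !=set0.

Lemma tree_rank_ge_sub k (S S' : set X) :
  S `<=` S' -> tree_rank_ge k S -> tree_rank_ge k S'.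
Proof.
elim: k S S' => [|k IH] S S' SS' /=; first by move=> [x /SS' S'x]; exists x.
by move=> [y [HP HQ]]; exists y; split;
  [apply: IH HP|apply: IH HQ]; exact: setSI.
Qed.

Lemma tree_rank_geW j k (S : set X) :
  (j <= k)%N -> tree_rank_ge k S -> tree_rank_ge j S.
Proof.
elim: k => [|k IH]; first by rewrite leqn0 => /eqP->.
rewrite leq_eqVlt => /orP[/eqP->//|/IH{}IH] [y [HP _]].
by apply: IH; apply: tree_rank_ge_sub HP => x [].
Qed.

Definition branch (p : Prop) (x : X) (y : Y) : Prop := (p -> P x y) /\ (~ p -> Q x y).

(** A tree of height [size s], with its levels named by the elements of s.
    Encoding a branch by a set f of levels (those where it takes the P side)
    lets the nodes be functions of a level and of a branch through it; that a
    node depends only on the part of the branch below it is the last equation.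
    Branches and nodes are thus indexed by all of T, not only by s, which is the
    form needed to assemble such trees for all finite s at once. *)
Lemma tree_of_rank (T : eqType) (lt : T -> T -> Prop) (s : seq T) (S : set X) (y0 : Y) :
  strict_well_order lt ->
  pairwise (fun x y => `[< lt x y >]) s -> tree_rank_ge (size s) S ->
  exists (x : set T -> X) (y : T -> set T -> Y), forall f, S (x f) /\
    forall i, i \in s -> branch (f i) (x f) (y i f) /\
      y i (f `&` initial_segment lt i) = y i f.
Proof.
move=> wo; elim: s S => [|d s IH] S /=.
  by move=> _ [x Sx]; exists (fun=> x), (fun _ _ => y0).
move=> /andP[/allP ds spw] [c [rP rQ]].
have [x1 [y1 H1]] := IH _ spw rP; have [x2 [y2 H2]] := IH _ spw rQ.
(* c is the root, at level d; above it f continues in one of two trees. *)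
exists (fun f => if pselect (f d) then x1 f else x2 f).
exists (fun i f => if i == d then c else if pselect (f d) then y1 i f else y2 i f).
move=> f; split; first by case: pselect => fd; [case: (H1 f) => -[]|case: (H2 f) => -[]].
move=> i; rewrite inE; have [-> _|id /= si] := eqVneq i d.
  split=> //; case: pselect => fd; first by case: (H1 f) => -[_ ?] _; split.
  by case: (H2 f) => -[_ ?] _; split.
have di : lt d i by apply/asboolP/ds.
have fd : (f d /\ initial_segment lt i d) = f d.
  by apply/propext; split=> [[]//|fd]; split.
rewrite fd; case: pselect => {}fd; first by case: (H1 f) => _ /(_ _ si).
by case: (H2 f) => _ /(_ _ si).
Qed.

End TreeRank.

(** * Instances of formulas *)

Section Formulas.
Variables (L : signature) (M : structure L).

Lemma psat_instance n m (phi : formula L (n + m)) (a : n.-tuple M) (b : m.-tuple M) :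
  psat (tnth a) (instance phi b) = holds phi (cat_tuple a b).
Proof.
rewrite /psat /=; suff -> : map_tuple (tnth a) (ord_tuple n) = a by [].
by apply: eq_from_tnth => i; rewrite tnth_map tnth_ord_tuple.
Qed.

Lemma tp_phi_instance n m (phi : formula L (n + m)) (a : n.-tuple M) (B : set M)
    (b : m.-tuple M) :
  tp_phi phi a B (instance phi b) <-> tuple_in B b /\ holds phi (cat_tuple a b).
Proof.
split=> [[c [Bc ac] e]|[Bb ab]]; last by exists b => //; split; rewrite ?psat_instance.
split; last by rewrite -psat_instance -e.
by have : tuple_in B (ppar (instance phi c)) by []; rewrite e.
Qed.

(** The cast is there because the number of free variables of the body of a
    parameter-free formula is N + 0. *)
Definition unparameterized (V : Type) N (phi : formula L N) (w : N.-tuple V) :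
    pformula L V M :=
  PFormula (ecast k (formula L k) (esym (addn0 N)) phi) w [tuple].

Lemma psat_unparameterized (V : Type) N (phi : formula L N) (w : N.-tuple V) (a : V -> M) :
  psat a (unparameterized phi w) = holds phi (map_tuple a w).
Proof.
have castE k (e : N = k) (u : N.-tuple M) (v : k.-tuple M) : val u = val v ->
    holds (ecast k (formula L k) e phi) v = holds phi u.
  by case: k / e v => v /val_inj->.
by apply: castE; rewrite /= cats0.
Qed.

End Formulas.

Lemma small_of_card_le (K Lam U : Type) (A : set U) :
  small K [set: Lam] -> A #<= [set: Lam] -> small K A.
Proof.
move=> [LamK nKLam] ALam; split; first exact: card_le_trans LamK.
by move=> KA; apply: nKLam; exact: card_le_trans ALam.
Qed.

Lemma structure_point (L : signature) (M : structure L) : M.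
Proof.
suff /cid[] : exists x : M, True by [].
by case: (carrier_inhabited M) => x; exists x.
Qed.

(** * Stable formulas have finite rank *)

Section FiniteRank.
Variables (K : Type) (L : signature) (T : theory L) (M : monster K T).
Variables (n m : nat) (phi psi : formula L (n + m)).

Let P (a : n.-tuple M) (b : m.-tuple M) := holds phi (cat_tuple a b).
Let Q (a : n.-tuple M) (b : m.-tuple M) := holds psi (cat_tuple a b).

Let signed (p : Prop) := if pselect p then phi else psi.

Let signedP p a b : holds (signed p) (cat_tuple a b) <-> branch P Q p a b.
Proof.
rewrite /signed; case: pselect => hp; split=> [ab|[hP hQ]];
  by [split|exact: hP|exact: hQ].
Qed.

(** The realizations of the branches in N and the nodes are all unknowns of one
    set of formulas, of size at most Lam: one formula for each f in N and each
    level i. A finite part of it mentions finitely many levels, and a tree with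
    exactly these levels satisfies it. *)
Lemma saturated_tree (Lam : eqType) (lt : Lam -> Lam -> Prop) (mu : set Lam)
    (N : set (set Lam)) :
  strict_well_order lt -> small_infinite K Lam -> N #<= [set: Lam] ->
  (forall k, tree_rank_ge P Q k setT) ->
  exists (x : set Lam -> n.-tuple M) (y : Lam -> set Lam -> m.-tuple M),
    forall f i, N f -> mu i ->
      branch P Q (f i) (x f) (y i (f `&` initial_segment lt i)).
Proof.
move=> wo [infLam smLam] NLam rk.
have [lam0 _] := infinite_setN0 infLam.
pose V : Type := (set Lam * 'I_n + Lam * set Lam * 'I_m)%type.
pose w (f : set Lam) (i : Lam) : (n + m).-tuple V :=
  cat_tuple [tuple inl (f, j) | j < n]
    [tuple inr (i, f `&` initial_segment lt i, j) | j < m].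
pose theta (p : set Lam * Lam) : pformula L V M :=
  unparameterized M (signed (p.1 p.2)) (w p.1 p.2).
have thetaP (a : V -> M) p : psat a (theta p) <-> branch P Q (p.1 p.2)
    [tuple a (inl (p.1, j)) | j < n]
    [tuple a (inr (p.2, p.1 `&` initial_segment lt p.2, j)) | j < m].
  rewrite -signedP psat_unparameterized.
  suff -> : map_tuple a (w p.1 p.2) = cat_tuple [tuple a (inl (p.1, j)) | j < n]
    [tuple a (inr (p.2, p.1 `&` initial_segment lt p.2, j)) | j < m] by [].
  by apply: val_inj; rewrite /= map_cat -!map_comp.
have [||a aP] := monster_saturated (Sigma := theta @` (N `*` mu)).
- apply: (small_of_card_le smLam); apply: card_le_image_le.
  by apply: card_le_setX => //; exact: card_leT.
- move=> F finF FS.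
  have [|p pP] := @choice_on _ _ F (fun th p => theta p = th) (set0, lam0).
    by move=> th /FS[p _ <-]; exists p.
  have [s spw sP] := finite_strictly_sorted wo (finite_image (snd \o p) finF).
  have [x [y xyP]] :=
    tree_of_rank [tuple structure_point M | _ < m] wo spw (rk (size s)).
  exists (fun v => match v with
                   | inl (f, j) => tnth (x f) j
                   | inr (i, f, j) => tnth (y i f) j
                   end).
  move=> th Fth; rewrite -(pP _ Fth); apply/thetaP.
  have : (p th).2 \in s by apply/sP; exists th.
  case: (p th) => f i /= si; have [_ /(_ _ si)[xy e]] := xyP f.
  have mkE (l : nat) (u : l.-tuple M) : [tuple tnth u j | j < l] = u.
    by apply: eq_from_tnth => j; rewrite tnth_mktuple.
  by rewrite !mkE e.
exists (fun f => [tuple a (inl (f, j)) | j < n]).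
exists (fun i g => [tuple a (inr (i, g, j)) | j < m]).
by move=> f i Nf mui; apply/(thetaP a (f, i))/aP; exists (f, i).
Qed.

(** The tree is now made of parameters. Its branches need not be realized
    together, of which there may be too many for saturation, but one at a time:
    any finitely many levels lie at or below one of them, k, and there f agrees
    with the realized branch that stops at k. *)
Lemma saturated_branch (Lam : eqType) (lt : Lam -> Lam -> Prop) (mu : set Lam)
    (x : set Lam -> n.-tuple M) (y : Lam -> set Lam -> m.-tuple M) :
  strict_well_order lt -> small_infinite K Lam -> 
  (forall f i, (exists2 k, mu k & f `<=` k |` initial_segment lt k) -> mu i ->
     branch P Q (f i) (x f) (y i (f `&` initial_segment lt i))) ->
  forall f : set Lam, exists a : n.-tuple M,
    forall i, mu i -> branch P Q (f i) a (y i (f `&` initial_segment lt i)).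
Proof.
move=> wo [infLam smLam] xyP f.
have [lam0 _] := infinite_setN0 infLam.
pose theta i : pformula L 'I_n M :=
  instance (signed (f i)) (y i (f `&` initial_segment lt i)).
have [||a aP] := monster_saturated (Sigma := theta @` mu).
- by apply: (small_of_card_le smLam); apply: card_le_image_le; exact: card_leT.
- move=> F finF FS.
  have [|p pP] := @choice_on _ _ F (fun th i => mu i /\ theta i = th) lam0.
    by move=> th /FS[i mui <-]; exists i.
  have [s spw sP] := finite_strictly_sorted wo (finite_image p finF).
  case: (lastP s) spw sP => [|s' k] spw sP.
    exists (fun=> structure_point M) => th Fth.
    by have : p th \in [::] by apply/sP; exists th.
  have muk : mu k.
    have /sP[th Fth <-] : k \in rcons s' k by rewrite mem_rcons mem_head.
    by case: (pP _ Fth).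
  (* The branch that follows f up to its last relevant level k. *)
  pose g := f `&` (k |` initial_segment lt k).
  exists (tnth (x g)) => th Fth; have [mup <-] := pP _ Fth.
  have kp : p th = k \/ lt (p th) k.
    have : p th \in rcons s' k by apply/sP; exists th.
    rewrite mem_rcons inE => /orP[/eqP->|ps]; first by left.
    by move: spw; rewrite pairwise_rcons => /andP[/allP/(_ _ ps)/asboolP]; right.
  have gp : g (p th) = f (p th).
    by apply/propext; split=> [[]|fp].
  have gseg : g `&` initial_segment lt (p th) = f `&` initial_segment lt (p th).
    apply/seteqP; split=> i [fi ip]; split=> //; first by case: fi.
    by split=> //; right; case: kp => [<-//|kp]; exact: (swo_trans wo ip kp).
  rewrite /theta psat_instance signedP -gp -gseg.
  by apply: xyP => //; exists k => // i [].
exists [tuple a j | j < n] => i mui.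
rewrite -signedP; have := aP _ (ex_intro2 _ _ i mui erefl).
rewrite -psat_instance; suff -> : tnth [tuple a j | j < n] = a by [].
by apply/funext => j; rewrite tnth_mktuple.
Qed.

(** Two branches f and g of the tree of height mu first differ at some level i.
    They share the node there, whose parameter then satisfies phi with the
    realization of one and psi with that of the other, so the phi-types of
    the realizations are distinct. *)
Lemma stable_finite_rank : negation T phi psi -> stable_formula M phi ->
  exists k, ~ tree_rank_ge P Q k setT.
Proof.
move=> neg [Lam]; elim/Peq: Lam => Lam [smLam stab].
apply/existsNP => rk; have infLam := smLam.1.
have [lt wo] := strict_well_order_exists Lam.
have [mu [mubig musmall]] := critical_height wo.
have [x [y xyP]] :=
  saturated_tree mu wo smLam (card_le_bounded_subsets infLam musmall) rk.
have [|z zP] := choice (saturated_branch (mu := mu) (x := x) (y := y) wo smLam _).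
  by move=> f i [k muk fk] mui; apply: xyP => //; exists k.
pose B : set M :=
  \bigcup_(i in mu) \bigcup_(f in [set f | f `<=` initial_segment lt i])
  range (tnth (y i f)).
have BLam : B #<= [set: Lam].
  apply: card_le_bigcup => // [|i /musmall mui]; first exact: card_leT.
  apply: card_le_bigcup => // f _; apply: card_le_image_le.
  by apply: finite_card_le => //; exact: finite_finset.
apply: mubig; apply: card_le_trans (stab _ BLam).
apply: (@card_le_inj _ _ _ _ (fun f => tp_phi phi (z f) B)) =>
  [f _|f g fmu gmu tpE].
  by exists (z f).
apply: contrapT => fg.
have [|i fgi imin] := swo_min wo (A := [set i | f i <> g i]).
  apply: contrapT => nfg; apply: fg; apply/funext => i.
  by apply: contrapT => fgi; apply: nfg; exists i.
have segE : f `&` initial_segment lt i = g `&` initial_segment lt i.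
  apply/seteqP; split=> j [fj ji]; split=> //.
    by have /contrapT <- : ~ (f j <> g j) by move=> /imin.
  by have /contrapT -> : ~ (f j <> g j) by move=> /imin.
have mui : mu i.
  have [fi|nfi] := pselect (f i); first exact: fmu.
  have [gi|ngi] := pselect (g i); first exact: gmu.
  by exfalso; apply: fgi; apply/propext; split.
have clash (u v : set Lam) :
    tp_phi phi (z u) B = tp_phi phi (z v) B -> u i -> ~ v i ->
    u `&` initial_segment lt i <> v `&` initial_segment lt i.
  move=> uvE ui nvi segE'.
  have [/(_ ui) Pu _] := zP u _ mui; have [_ /(_ nvi) Qv] := zP v _ mui.
  have : tp_phi phi (z u) B (instance phi (y i (u `&` initial_segment lt i))).
    apply/tp_phi_instance; split=> // j; exists i => //.
    by exists (u `&` initial_segment lt i); [move=> k []|exists j].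
  rewrite uvE => /tp_phi_instance[_ Pv]; rewrite segE' in Pv.
  apply: (neg M (monster_ec M).1).
  by exists (cat_tuple (z v) (y i (v `&` initial_segment lt i))); split.
have [fi|nfi] := pselect (f i).
  apply: (clash f g) => // gi; apply: fgi; exact/propext.
apply: (clash g f) => //; apply: contrapT => ngi; apply: fgi; exact/propext.
Qed.

End FiniteRank.

(** * Codes for types *)

Lemma card_le_range X U W (f : X -> U) (c : X -> W) (x0 : X) :
  (forall x y, c x = c y -> f x = f y) -> range f #<= [set: W].
Proof.
move=> cf; have [|g gf] := @choice_on _ _ (range f) (fun u x => f x = u) x0.
  by move=> _ [x _ <-]; exists x.
apply: (@card_le_inj _ _ _ _ (c \o g)) => // u v fu fv /= /cf.
by rewrite !gf.
Qed.

Lemma card_le_setT_injP J U :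
  [set: J] #<= [set: U] -> exists g : J -> U, injective g.
Proof.
move=> JU; have [[u _]|noU] := pselect (exists u : U, True).
  have [g _ gI] := card_le_injP u JU.
  by exists g => i j; exact: gI.
have noJ : J -> False.
  move=> j; have U0 : [set: U] = set0.
    by apply/seteqP; split=> // u; case: noU; exists u.
  by move: JU; rewrite U0 card_le0 => /eqP/seteqP[/(_ j I)].
by exists (fun j => False_rect U (noJ j)) => j; case: (noJ j).
Qed.

Lemma card_le_exponent J J' W (w0 : W) :
  [set: J] #<= [set: J'] -> [set: J -> W] #<= [set: J' -> W].
Proof.
move=> /card_le_setT_injP[g gI].
have [|e eP] := @choice (J -> W) (J' -> W) (fun f h => forall j, h (g j) = f j).
  move=> f; have [|h hP] := @choice_on _ _ (range g)
    (fun k w => exists2 j, g j = k & f j = w) w0.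
    by move=> _ [j _ <-]; exists (f j), j.
  by exists h => j; have [|i /gI->//] := hP (g j); exists j.
apply: (@card_le_inj _ _ _ _ e) => // f f' _ _ ff'.
by apply/funext => j; rewrite -!eP ff'.
Qed.

Section Minimizing.
Variables (X Y : Type) (P Q : X -> Y -> Prop) (A : set Y).

Definition cut (s : seq (bool * Y)) : set X :=
  foldr (fun e S => S `&` (if e.1 then P^~ e.2 else Q^~ e.2)) setT s.

(** The product form is the one in which [card_le_seq] and [card_le_setX] count
    the lists over A. *)
Definition over (s : seq (bool * Y)) : Prop :=
  all (fun e => `[< ([set: bool] `*` A) e >]) s.

(** [cut s] has the least rank among the sets cut out by finitely many
    conditions over A that hold of a. The comparison of ranks quantifies over j
    so that the rank itself need not be defined. *)
Definition minimizing (a : X) (s : seq (bool * Y)) : Prop :=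
  [/\ over s, cut s a & forall s' j, over s' -> cut s' a ->
      tree_rank_ge P Q j (cut s) -> tree_rank_ge P Q j (cut s')].

Lemma exists_minimizing (a : X) k : ~ tree_rank_ge P Q k setT ->
  exists s, minimizing a s.
Proof.
move=> rk.
pose p j :=
  `[< exists s, [/\ over s, cut s a & ~ tree_rank_ge P Q j (cut s)] >].
have pk : exists j, p j by exists k; apply/asboolP; exists [::].
case: (ex_minnP pk) => j /asboolP[s [As sa rs]] jmin.
exists s; split=> // s' i As' sa' ri.
have [ij|/tree_rank_geW/(_ ri)//] := ltnP i j.
apply: contrapT => nri; have : p i by apply/asboolP; exists s'.
by move=> /jmin; rewrite leqNgt ij.
Qed.

(** Adding the condition P(., y) to s keeps the rank because s is minimizing for
    a, and adding Q(., y) keeps it because s is minimizing for b. So the set cut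
    out by s splits into two parts of the same rank, and by induction this rank
    exceeds every k. *)
Lemma minimizing_separates (a b : X) s k y : ~ tree_rank_ge P Q k setT ->
  minimizing a s -> minimizing b s -> A y -> P a y -> ~ Q b y.
Proof.
move=> rk [As sa amin] [_ sb bmin] Ay Pay Qby.
have : tree_rank_ge P Q k (cut s).
  elim: k {rk} => [|k IH]; first by exists a.
  exists y; split.
    apply: (amin ((true, y) :: s)) => //.
    by apply/andP; split=> //; apply/asboolP.
  apply: (bmin ((false, y) :: s)) => //.
  by apply/andP; split=> //; apply/asboolP.
by move=> /(tree_rank_ge_sub (@subsetT _ _)).
Qed.

End Minimizing.

Section AllFormulas.
Variable L : signature.

Lemma infinite_all_formulas : infinite_set [set: all_formulas L].
Proof.
apply/infiniteP.
apply: (@card_le_inj _ _ _ _ (fun n => Tagged (formula L) (Top L n))) => //.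
by move=> i j _ _ /(congr1 tag).
Qed.

Lemma Tagged_formula_inj n (f g : formula L n) :
  Tagged (formula L) f = Tagged (formula L) g -> f = g.
Proof. exact: eq_from_Tagged. Qed.

(** A formula over parameters from B, with the parameters left out: a formula
    together with a choice of the variables put in its first k places. *)
Definition formula_shape (n : nat) : Type :=
  {k : nat & {p : nat & (formula L (k + p) * k.-tuple 'I_n)%type}}.

(** The formula is recorded with its total number k + p of variables; k and the
    k.-tuple add only countably much. *)
Lemma card_le_formula_shape n : [set: formula_shape n] #<= [set: all_formulas L].
Proof.
have infAF := infinite_all_formulas.
have : [set: all_formulas L] `*` [set: nat * seq nat] #<= [set: all_formulas L].
  apply: card_le_setX => //.
  apply: (@card_le_trans _ _ _ [set: nat]); last exact/infiniteP.
  exact: countableP.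
apply: card_le_trans.
pose code (r : formula_shape n) : all_formulas L * (nat * seq nat) :=
  (Tagged (formula L) (projT2 (projT2 r)).1,
   (projT1 r, map val (projT2 (projT2 r)).2)).
apply: (@card_le_inj _ _ _ _ code) => // -[k [p [f v]]] [k' [p' [f' v']]] _ _.
move=> e; have ff' := congr1 fst e; have kk' : k = k' := congr1 (fst \o snd) e.
have vv' : map val v = map val v' := congr1 (snd \o snd) e.
move: v' f' ff' {e} vv'; rewrite -{k'}kk' /= => v' f' ff' vv'.
have pp' : p = p' by move: ff' => /(congr1 tag) /addnI.
move: f' ff'; rewrite -{p'}pp' => f' /Tagged_formula_inj->.
by have -> : v = v' by apply/val_inj/(inj_map val_inj).
Qed.

End AllFormulas.

Section Counting.
Variables (K : Type) (L : signature) (T : theory L) (M : monster K T).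
Variable Lam : Type.
Hypotheses (infLam : infinite_set [set: Lam])
  (expLam : [set: all_formulas L -> Lam] #<= [set: Lam]).

Let lam0 : Lam.
Proof. by have /cid[] : [set: Lam] !=set0 := infinite_setN0 infLam. Qed.

(** Each a is coded by the function sending psi to a list minimizing the rank for
    phi and psi. *)
Lemma finite_rank_types_phi n m (phi : formula L (n + m)) (B : set M) :
  (forall psi, negation T phi psi -> exists k,
    ~ tree_rank_ge
        (fun (a : n.-tuple M) (b : m.-tuple M) => holds phi (cat_tuple a b))
        (fun a b => holds psi (cat_tuple a b)) k setT) ->
  B #<= [set: Lam] -> types_phi phi B #<= [set: Lam].
Proof.
move=> rk BLam; apply: card_le_trans expLam.
pose P (f : formula L (n + m)) (a : n.-tuple M) (b : m.-tuple M) :=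
  holds f (cat_tuple a b).
pose A : set (m.-tuple M) := [set b | tuple_in B b].
pose good psi := minimizing (P phi) (P psi) A.
(* The codes are indexed by all formulas; only those in n + m variables that
   are negations of phi constrain them. *)
have [|code codeP] :=
  @choice (n.-tuple M * all_formulas L) (seq (bool * m.-tuple M))
  (fun x s => over A s /\ forall psi, x.2 = Tagged (formula L) psi ->
     negation T phi psi -> good psi x.1 s).
  move=> [a f]; have [[psi [fE neg]]|no] := pselect (exists psi :
      formula L (n + m), f = Tagged (formula L) psi /\ negation T phi psi).
    have [k rkk] := rk _ neg; have [s sP] := exists_minimizing A a rkk.
    exists s; split=> [|psi' /=]; first by case: sP.
    by rewrite fE => /Tagged_formula_inj <-.
  by exists [::]; split=> // psi fE neg; case: no; exists psi.
have /(card_le_injP lam0)[c _ cI] : [set s | over A s] #<= [set: Lam].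
  apply: card_le_seq => //; apply: card_le_setX => //.
    exact: finite_card_le.
  exact: card_le_tuple.
apply: (@card_le_range _ _ _ (fun a => tp_phi phi a B)
  (fun a f => c (code (a, f)))).
  exact: [tuple structure_point M | _ < n].
have sub a a' : (fun f => c (code (a, f))) = (fun f => c (code (a', f))) ->
    tp_phi phi a B `<=` tp_phi phi a' B.
  move=> e _ [b [Bb]] + <-; rewrite psat_instance => ab.
  apply/tp_phi_instance; split=> //.
  apply: contrapT => na'b.
  have [psi [neg a'b]] := (monster_ec M).2 _ _ _ na'b.
  have ceq : code (a, Tagged (formula L) psi) =
             code (a', Tagged (formula L) psi).
    apply: cI; [exact: (codeP _).1|exact: (codeP _).1|].
    exact: (congr1 (fun h => h (Tagged (formula L) psi)) e).
  have [k rkk] := rk _ neg.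
  apply: (minimizing_separates rkk
    (s := code (a, Tagged (formula L) psi))) Bb ab a'b.
  - exact: (codeP (a, _)).2.
  - by rewrite ceq; exact: (codeP (a', _)).2.
by move=> a a' e; apply/seteqP; split; exact: sub.
Qed.

(** A formula over B in the type of a may repeat, permute or omit variables, so
    it says that some f(x, b) holds of a subtuple x of a rather than of a
    itself. *)
Lemma types_of_types_phi (B : set M) n :
  (forall k m (phi : formula L (k + m)), types_phi phi B #<= [set: Lam]) ->
  types n B #<= [set: Lam].
Proof.
move=> small; apply: card_le_trans expLam.
apply: card_le_trans (card_le_exponent lam0 (card_le_formula_shape L n)).
have [c cI] : exists c : forall k p,
    formula L (k + p) -> set (pformula L 'I_k M) -> Lam,
    forall k p (phi : formula L (k + p)),
      injective_on (types_phi phi B) (c k p phi).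
  have cP k p (phi : formula L (k + p)) :
      {f : set (pformula L 'I_k M) -> Lam | injective_on (types_phi phi B) f}.
    by apply: cid; have [f _ fI] := card_le_injP lam0 (small _ _ phi); exists f.
  by exists (fun k p phi => sval (cP k p phi)) => k p phi; exact: svalP.
pose sub (a : n.-tuple M) k (v : k.-tuple 'I_n) := map_tuple (tnth a) v.
apply: (@card_le_range _ _ _ (fun a : n.-tuple M => tp (tnth a) B)
  (fun a r => let: existT k (existT p (f, v)) := r in
              c k p f (tp_phi f (sub a k v) B))).
  exact: [tuple structure_point M | _ < n].
have incl a a' : (forall k p (f : formula L (k + p)) (v : k.-tuple 'I_n),
      tp_phi f (sub a k v) B = tp_phi f (sub a' k v) B) ->
    tp (tnth a) B `<=` tp (tnth a') B.
  move=> e [k p f v b] [/= Bb ab]; split=> //.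
  have : tp_phi f (sub a k v) B (instance f b) by apply/tp_phi_instance.
  by rewrite e => /tp_phi_instance[].
move=> a a' e.
have E k p (f : formula L (k + p)) (v : k.-tuple 'I_n) :
    tp_phi f (sub a k v) B = tp_phi f (sub a' k v) B.
  apply: (cI k p f); [by exists (sub a k v)|by exists (sub a' k v)|].
  exact: (congr1 (fun h => h (existT _ k (existT _ p (f, v)))) e).
by apply/seteqP; split; apply: incl => *; rewrite E.
Qed.

End Counting.

(** * The equivalence *)

(** By currying, (2^|T|)^|T| = 2^(|T| * |T|) = 2^|T|. *)
Lemma power_of_all_formulas (L : signature) (Lam := all_formulas L -> bool) :
  infinite_set [set: Lam] /\ [set: all_formulas L -> Lam] #= [set: Lam].
Proof.
have infAF := @infinite_all_formulas L.
split.
  apply/infiniteP; apply: card_le_trans ((infiniteP _).1 infAF) _.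
  apply: (@card_le_inj _ _ _ _ (fun x y => `[< x = y >])) => // x y _ _.
  move=> /(congr1 (fun h => h y))/= e.
  by apply/asboolP; rewrite e; apply/asboolP.
apply/card_eqPle; split; last first.
  apply: (@card_le_inj _ _ _ _ (fun f _ => f)) => // f g _ _.
  by move=> /(congr1 (fun h => h (Tagged (formula L) (Top L 0)))).
apply: card_le_trans (card_le_exponent true (card_le_square infAF)).
apply: (@card_le_inj _ _ _ _ (fun f x => f x.1 x.2)) => // f g _ _ e.
apply/funext => x; apply/funext => y.
exact: (congr1 (fun h => h (x, y)) e).
Qed.

Section StableFormulas.
Variables (K : Type) (L : signature) (T : theory L) (M : monster K T).

Lemma stable_stable_formula n m (phi : formula L (n + m)) :
  stable M -> stable_formula M phi.
Proof.
move=> [Lam [smLam stab]]; exists Lam; split=> // B /stab/(_ n).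
apply: card_le_trans.
have [|a aP] := @choice_on _ _ (types_phi phi B)
  (fun p a => tp_phi phi a B = p) [tuple structure_point M | _ < n].
  by move=> _ [a _ <-]; exists a.
apply: (@card_le_inj _ _ _ _ (fun p => tp (tnth (a p)) B)) =>
  [p _|p q /aP pE /aP qE e].
  by exists (a p).
rewrite -pE -qE; apply/seteqP.
split=> _ [b [Bb ab] <-]; exists b => //; split=> //.
  have : tp (tnth (a p)) B (instance phi b) by split.
  by rewrite e => -[].
have : tp (tnth (a q)) B (instance phi b) by split.
by rewrite -e => -[].
Qed.

Lemma stable_formulas_lambda_stable (Lam : Type) :
  (forall n m (phi : formula L (n + m)), stable_formula M phi) ->
  infinite_set [set: Lam] -> [set: all_formulas L -> Lam] #<= [set: Lam] ->
  lambda_stable M Lam.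
Proof.
move=> stab infLam expLam B BLam n; apply: types_of_types_phi => // k m phi.
by apply: finite_rank_types_phi => // psi neg; exact: stable_finite_rank.
Qed.

End StableFormulas.

Theorem theorem3p15 (L : signature) (T : theory L) (hJCP : joint_continuation T)
    (K : Type) (M : monster K T) :
  (stable M <->
   forall (n m : nat) (phi : formula L (n + m)), stable_formula M phi) /\
  (stable M <->
   forall Lam : Type, small_infinite K Lam ->
     [set: all_formulas L -> Lam] #= [set: Lam] -> lambda_stable M Lam).
Proof.
have power : (forall Lam : Type, small_infinite K Lam ->
    [set: all_formulas L -> Lam] #= [set: Lam] -> lambda_stable M Lam) -> stable M.
  have [infLam expLam] := power_of_all_formulas L.
  move=> stab; have smLam := monster_large M.
  by exists (all_formulas L -> bool); split; [|apply: stab].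
have formulas :
    (forall (n m : nat) (phi : formula L (n + m)), stable_formula M phi) ->
    forall Lam : Type, small_infinite K Lam ->
    [set: all_formulas L -> Lam] #= [set: Lam] -> lambda_stable M Lam.
  move=> stab Lam [infLam _] /card_eqPle[expLam _].
  exact: stable_formulas_lambda_stable.
split; split=> [st|]; [|by move/formulas/power| |exact: power].
  by move=> n m phi; exact: stable_stable_formula.
by apply: formulas => n m phi; exact: stable_stable_formula.
Qed.
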